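(* Assume that $(X,T)$ is a skew product of a compact metric group $G$ over a minimal equicontinuous system $(Y,S)$. The following statements are equivalent: (1) $Y\times\{e\}\in K(X)$ is recurrent for $T_K$, where $e$ is the unit of $G$; (2) $Y\times\{g\}\in K(X)$ is recurrent for $T_K$ for some $g\in G$; (3) $(K(X),T_K)$ is pointwise recurrent; (4) $(X,T)$ is uniformly rigid.
   Context: A t.d.s. is a pair $(Y,S)$ with $Y$ a compact metric space (metric $d$) and $S:Y\to Y$ continuous and surjective. It is minimal if every point has dense forward orbit, and equicontinuous if for each $y\in Y$ and $\varepsilon>0$ there is $\delta>0$ with $\mathrm{diam}\,S^n(B(y,\delta))<\varepsilon$ for all $n\ge0$ (then $S$ is a homeomorphism). A skew product of a compact metric group $G$ over $(Y,S)$ is the system $X=Y\times G$, $T(y,g)=(Sy,\phi(y)g)$, where $\phi:Y\to G$ is a continuous map. $K(X)$ is the set of non-empty closed subsets of $X$ with the Hausdorff metric, and $T_K(A)=T(A)$. For a homeomorphism $R$ of a compact metric space $Z$, a point $z$ is recurrent if there is a sequence of integers $n_i\to+\infty$ or a sequence $n_i\to-\infty$ with $R^{n_i}z\to z$; $(Z,R)$ is pointwise recurrent if every point is recurrent, and uniformly rigid if there is a sequence of positive integers $m_i\to\infty$ with $R^{m_i}\to\mathrm{id}$ uniformly on $Z$. *)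

(* Defs.v *)
From HB Require Import structures.
From mathcomp Require Import all_boot all_order all_algebra.
From mathcomp Require Import all_classical all_reals all_analysis.

Set Implicit Arguments.
Unset Strict Implicit.
Unset Printing Implicit Defensive.
Import Order.TTheory GRing.Theory Num.Theory.
Import numFieldTopology.Exports.
Local Open Scope classical_set_scope.
Local Open Scope ring_scope.

HB.mixin Record isCompactSpace T & Topological T := {
  compact_space : compact [set: T]
}.

#[short(type="compactSpaceType")]
HB.structure Definition CompactSpace := {T of Topological T & isCompactSpace T}.

#[short(type="compactMetricType")]
HB.structure Definition CompactMetric (R : numDomainType) :=
  {M of Metric R M & CompactSpace M}.

HB.mixin Record hasContinuousGroupLaw G & Topological G & Group G := {
  mulg_continuous : continuous (fun p : G * G => (p.1 * p.2)%g);
  invg_continuous : continuous (fun g : G => g^-1%g)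
}.

#[short(type="topologicalGroupType")]
HB.structure Definition TopologicalGroup :=
  {G of Topological G & Group G & hasContinuousGroupLaw G}.

(* The metric is only required to induce the group topology; no invariance
   under translations is assumed. *)
#[short(type="compactMetricGroupType")]
HB.structure Definition CompactMetricGroup (R : numDomainType) :=
  {G of CompactMetric R G & TopologicalGroup G}.

Section product.
Context {R : realType}.

Section metric.
Context {U V : metricType R}.
Implicit Types p q : U * V.

(* The balls of the library's product are products of balls. *)
Definition prod_mdist p q : R := Num.max (mdist p.1 q.1) (mdist p.2 q.2).

Lemma prod_mdist_ge0 p q : 0 <= prod_mdist p q.
Proof. by rewrite le_max mdist_ge0. Qed.

Lemma prod_mdist_positivity p q : prod_mdist p q = 0 -> p = q.
Proof.
case: p q => [p1 p2] [q1 q2] pq0.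
have : prod_mdist (p1, p2) (q1, q2) <= 0 by rewrite pq0.
rewrite ge_max /= => /andP[h1 h2].
by congr pair; apply: mdist_positivity; apply/eqP;
  rewrite eq_le mdist_ge0 andbT.
Qed.

Lemma prod_ballEmdist p (e : R) : ball p e = [set q | prod_mdist p q < e].
Proof.
apply/seteqP; split=> q; rewrite /ball/= /prod_ball !ballEmdist /= gt_max.
  by case=> -> ->.
by move/andP.
Qed.

HB.instance Definition _ := @PseudoMetric_isMetric.Build R (U * V)%type
  prod_mdist prod_mdist_ge0 prod_mdist_positivity prod_ballEmdist.

End metric.

Lemma prod_compact (U V : compactMetricType R) : compact [set: U * V].
Proof.
by rewrite -setXTT; apply: compact_setX; exact: compact_space.
Qed.

HB.instance Definition _ (U V : compactMetricType R) :=
  isCompactSpace.Build (U * V)%type (@prod_compact U V).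

End product.

Section hyperspace.
Context {R : realType}.

Record hyperspace (X : compactMetricType R) := Hyperspace {
  hset :> set X;
  hset_closed : closed hset;
  hset_neq0 : hset !=set0
}.

Section metric.
Context {X : compactMetricType R}.
Implicit Types A B C : hyperspace X.

Lemma hyperspace_eq A B : A = B :> set X -> A = B.
Proof.
case: A B => [A cA A0] [B cB B0] /= AB; move: cA A0 cB B0; rewrite AB => *.
by congr Hyperspace; exact: Prop_irrelevance.
Qed.

HB.instance Definition _ := gen_eqMixin (hyperspace X).
HB.instance Definition _ := gen_choiceMixin (hyperspace X).

Definition thickening (A : set X) (e : R) : set X := \bigcup_(a in A) ball a e.

Definition hausdorff_radii A B : set R :=
  [set e | [/\ 0 < e, A `<=` thickening B e & B `<=` thickening A e]].

Definition hausdorff_dist A B : R := inf (hausdorff_radii A B).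

Lemma compact_mdist_bounded : exists M : R, forall x y : X, mdist x y < M.
Proof.
have [[x0 _]|X0] := pselect ([set: X] !=set0); last first.
  by exists 0 => x; exfalso; apply: X0; exists x.
suff [M HM] : exists M : R, forall x : X, mdist x0 x < M.
  exists (M + M) => x y; rewrite (le_lt_trans (metric_triangle _ x0 _))//.
  by rewrite metric_sym ltrD.
have /compact_near_coveringP/(_ nat \oo (fun n x => mdist x0 x < n%:R)) :
  compact [set: X] by exact: compact_space.
move=> /(_ _)[x _|n _ Hn]; last by exists n%:R => x; exact: (Hn n (leqnn n) x I).
exists (ball x 1, [set n | mdist x0 x + 1 <= n%:R]).
  split; first exact: nbhsx_ballx.
  exists (Num.truncn (mdist x0 x + 1)).+1 => // n /=; rewrite -(ler_nat R).
  by apply: le_trans; rewrite ltW// truncnS_gt.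
move=> [y n]; rewrite ballEmdist /= => -[xy]; apply: lt_le_trans.
by rewrite (le_lt_trans (metric_triangle _ x _))// ltrD2l.
Qed.

Lemma hausdorff_radii_has_inf A B : has_inf (hausdorff_radii A B).
Proof.
have [M HM] := compact_mdist_bounded.
have [a Aa] := hset_neq0 A; have [b Bb] := hset_neq0 B.
split; last by exists 0 => e [/ltW].
exists M; split; first by rewrite (le_lt_trans _ (HM a b))// mdist_ge0.
- by move=> x _; exists b => //; rewrite ballEmdist /=.
- by move=> x _; exists a => //; rewrite ballEmdist /=.
Qed.

Lemma hausdorff_dist_sym A B : hausdorff_dist A B = hausdorff_dist B A.
Proof. by congr inf; apply/seteqP; split=> e [? ? ?]. Qed.

Lemma hausdorff_dist_xx A : hausdorff_dist A A = 0.
Proof.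
apply/eqP; rewrite eq_le; apply/andP; split.
  apply/ler_addgt0Pl => e e0; rewrite addr0.
  apply: ge_inf; first by case: (hausdorff_radii_has_inf A A).
  by split=> // x Ax; exists x => //; exact: ballxx.
by apply: lb_le_inf; [case: (hausdorff_radii_has_inf A A)|move=> e [/ltW]].
Qed.

Lemma thickening_le (A : set X) (e e' : R) :
  e <= e' -> thickening A e `<=` thickening A e'.
Proof. by move=> ee' x [a Aa ax]; exists a => //; exact: le_ball ax. Qed.

Lemma hausdorff_dist_lt A B (e : R) :
  hausdorff_dist A B < e -> hausdorff_radii A B e.
Proof.
move=> /(inf_lt (hausdorff_radii_has_inf A B).1)[r [r0 AB BA]] /ltW re.
split; first exact: lt_le_trans re.
- exact: subset_trans (thickening_le re).
- exact: subset_trans (thickening_le re).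
Qed.

Lemma hausdorff_dist_positivity A B : hausdorff_dist A B = 0 -> A = B.
Proof.
have sub C D : hausdorff_dist C D = 0 -> C `<=` D.
  move=> CD0 x Cx; rewrite (closure_id D).1; last exact: hset_closed.
  move=> U; rewrite -nbhs_ballE => -[e /= e0 xeU].
  have [_ /(_ x Cx)[d Dd dx] _] : hausdorff_radii C D e.
    by apply: hausdorff_dist_lt; rewrite CD0.
  by exists d; split=> //; apply: xeU; exact: ball_sym.
move=> AB0; apply: hyperspace_eq; apply/seteqP; split; first exact: sub.
by apply: sub; rewrite hausdorff_dist_sym.
Qed.

Lemma hausdorff_dist_triangle B A C :
  hausdorff_dist A C <= hausdorff_dist A B + hausdorff_dist B C.
Proof.
apply/ler_addgt0Pr => e e0; rewrite (splitr e) addrACA.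
have e20 : 0 < e / 2 by rewrite divr_gt0.
have [r0 AB BA] : hausdorff_radii A B (hausdorff_dist A B + e / 2).
  by apply: hausdorff_dist_lt; rewrite ltrDl.
have [s0 BC CB] : hausdorff_radii B C (hausdorff_dist B C + e / 2).
  by apply: hausdorff_dist_lt; rewrite ltrDl.
apply: ge_inf; first by case: (hausdorff_radii_has_inf A C).
split; first exact: addr_gt0.
- move=> x /AB[y /BC[z Cz zy] yx]; exists z => //.
  by rewrite addrC; exact: ball_triangle yx.
- move=> x /CB[y /BA[z Az zy] yx]; exists z => //.
  exact: ball_triangle yx.
Qed.

HB.instance Definition _ := @isMetric.Build R (hyperspace X) hausdorff_dist
  hausdorff_dist_xx hausdorff_dist_positivity hausdorff_dist_sym
  hausdorff_dist_triangle.

End metric.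

Section map.
Context {X : compactMetricType R} (f : continuousType X X).

Lemma image_closed (A : hyperspace X) : closed (f @` A).
Proof.
apply: compact_closed; first exact: metric_hausdorff.
apply: continuous_compact.
  by apply: continuous_subspaceT; exact: cts_fun.
apply: subclosed_compact (@compact_space X) _ => //; exact: hset_closed.
Qed.

Lemma image_neq0 (A : hyperspace X) : f @` A !=set0.
Proof. by apply: image_nonempty; exact: hset_neq0. Qed.

Definition hyperspace_map (A : hyperspace X) : hyperspace X :=
  Hyperspace (@image_closed A) (@image_neq0 A).

End map.
End hyperspace.

(* [pinv] is the library's total inverse: it is a junk value outside the image
   of [f] and the inverse of [f] when [f] is bijective (see [iterzN]).  The
   argument [id] only supplies that junk value. *)
Definition iterz {Z : Type} (f : Z -> Z) (n : int) : Z -> Z :=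
  match n with
  | Posz k => iter k f
  | Negz k => iter k.+1 ('pinv_id [set: Z] f)
  end.

Lemma iterzN {Z : Type} (f : Z -> Z) (n : nat) :
  bijective f -> cancel (iter n f) (iterz f (- n%:Z)) /\
                 cancel (iterz f (- n%:Z)) (iter n f).
Proof.
move=> [g fg gf]; set h := 'pinv_id [set: Z] f.
have hE : iterz f (- n%:Z) = iter n h by case: n => [|n] //; rewrite -NegzE.
have fh : cancel f h.
  by move=> z; apply: pinvKV; rewrite ?inE// => x y _ _; exact: can_inj fg x y.
have hf : cancel h f by move=> z; rewrite -[z in h z]gf fh gf.
by rewrite hE; split; elim: n {hE} => [|n IH] z //;
  rewrite iterSr iterS ?fh ?hf IH.
Qed.

Section dynamics.
Context {R : realType} {Z : metricType R}.

Definition diam (A : set Z) : R :=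
  sup [set mdist p.1 p.2 | p in A `*` A].

Definition minimal (f : Z -> Z) : Prop :=
  forall z, dense [set iter n f z | n in [set: nat]].

Definition equicontinuous_system (f : Z -> Z) : Prop :=
  forall (z : Z) (e : R), 0 < e -> exists2 d : R, 0 < d &
    forall n, diam (iter n f @` ball z d) < e.

Definition recurrent (f : Z -> Z) (z : Z) : Prop :=
  exists n : nat -> int,
    ((n i)%:~R @[i --> \oo] --> (+oo : set_system R)
     \/ (n i)%:~R @[i --> \oo] --> (-oo : set_system R))
    /\ iterz f (n i) z @[i --> \oo] --> z.

Definition pointwise_recurrent (f : Z -> Z) : Prop :=
  forall z, recurrent f z.

Definition uniformly_rigid (f : Z -> Z) : Prop :=
  exists m : nat -> nat,
    [/\ forall i, (0 < m i)%N,
        m i @[i --> \oo] --> \oo &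
        {uniform, (fun i => iter (m i) f) @ \oo --> (id : Z -> Z)}].

End dynamics.

Section skew_product.
Context {R : realType} {Y : compactMetricType R}
  {G : compactMetricGroupType R}.

Definition skew_product (S : Y -> Y) (phi : Y -> G) (x : Y * G) : Y * G :=
  (S x.1, (phi x.1 * x.2)%g).

Lemma skew_product_continuous (S : continuousType Y Y)
  (phi : continuousType Y G) : continuous (skew_product S phi).
Proof.
move=> x; apply: cvg_pair => /=.
  by apply: continuous_comp; [exact: cvg_fst|exact: cts_fun].
apply: (@continuous_comp _ _ _ (fun x : Y * G => (phi x.1, x.2))
  (fun p : G * G => (p.1 * p.2)%g)); last exact: mulg_continuous.
apply: cvg_pair => /=; last exact: cvg_snd.
by apply: continuous_comp; [exact: cvg_fst|exact: cts_fun].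
Qed.

HB.instance Definition _ (S : continuousType Y Y) (phi : continuousType Y G) :=
  isContinuous.Build _ _ (skew_product S phi) (@skew_product_continuous S phi).

Lemma slice_closed (g : G) : closed ([set: Y] `*` [set g]).
Proof.
apply: compact_closed; first exact: metric_hausdorff.
by apply: compact_setX; [exact: compact_space|exact: compact_set1].
Qed.

Lemma slice_neq0 (Y0 : [set: Y] !=set0) (g : G) :
  [set: Y] `*` [set g] !=set0.
Proof. by case: Y0 => y _; exists (y, g). Qed.

Definition slice (Y0 : [set: Y] !=set0) (g : G) : hyperspace (Y * G)%type :=
  Hyperspace (@slice_closed g) (@slice_neq0 Y0 g).

End skew_product.

(* Main.v *)
(* Write T^n (y, g) = (S^n y, c_n(y) g).  If Y x {g} is recurrent, then along
   some m_i -> oo the cocycle c_(m_i) tends to 1 uniformly, a negative time -n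
   giving the same information about c_n as n does.  By equicontinuity the
   iterates S^(m_i) are uniformly Cauchy along an ultrafilter, so there are
   i, j with m_j - m_i large and S^(m_i), S^(m_j) uniformly close.  Since
   c_(m_j - m_i)(S^(m_i) y) = c_(m_j)(y) c_(m_i)(y)^-1 and S^(m_i) is onto,
   T^(m_j - m_i) is uniformly close to the identity.  Conversely, the Hausdorff
   distance between A and T^m A is at most the uniform distance from T^m to the
   identity. *)
Require Import Defs.
From HB Require Import structures.
From mathcomp Require Import all_boot all_order all_algebra.
From mathcomp Require Import all_classical all_reals all_analysis.
Local Open Scope classical_set_scope.

Section recurrence_and_rigidity.
Set Implicit Arguments.
Unset Strict Implicit.
Unset Printing Implicit Defensive.
Import Order.TTheory GRing.Theory Num.Theory.
Import numFieldTopology.Exports.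
Local Open Scope ring_scope.
Context {R : realType}.

(** * Close iterates of equicontinuous systems *)

Lemma ultra_fmap (I Z : Type) (f : I -> Z) (U : set_system I) :
  UltraFilter U -> UltraFilter (f @ U).
Proof.
move=> UU; split; first exact: fmap_proper_filter.
move=> V VV UV; apply/seteqP; split=> // A VA; rewrite /fmap /=.
have [//|UCA] := in_ultra_setVsetC (f @^-1` A) UU.
have [z [Az nAz]] : A `&` ~` A !=set0.
  by apply: (@filter_ex _ V); apply: filterI => //; exact: (UV (~` A)).
by exfalso.
Qed.

Lemma mdist_le_diam (X : compactMetricType R) (A : set X) x y :
  A x -> A y -> mdist x y <= diam A.
Proof.
move=> Ax Ay; apply: ub_le_sup; last by exists (x, y).
have [M HM] := @compact_mdist_bounded R X.
by exists M => _ [p _ <-]; exact: ltW.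
Qed.

(** Along an ultrafilter finer than [\oo], each sequence [iter (m i) S x] converges by compactness,
    hence is Cauchy. Equicontinuity spreads the Cauchy estimate to a ball around [x], and
    compactness makes it uniform in [y]. As [i] and [j] range over large sets independently, [j] can
    be chosen after [i] with [m j] as large as required. *)
Lemma equicontinuous_iter_close (Y : compactMetricType R) (S : Y -> Y)
    (m : nat -> nat) (P : set nat) (e : R) (N : nat) :
  equicontinuous_system S -> m i @[i --> \oo] --> \oo -> \oo P -> 0 < e ->
  exists i j, [/\ P i, P j, (m i + N <= m j)%N &
    forall y, mdist (iter (m i) S y) (iter (m j) S y) < e].
Proof.
move=> S_equi m_oo P_oo e0.
have [U [UU ooU]] := ultraFilterLemma eventually_filter.
have e40 : 0 < e / 4 by rewrite divr_gt0.
have /compact_near_coveringP/(_ _ (filter_prod U U) (fun ij y =>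
    mdist (iter (m ij.1) S y) (iter (m ij.2) S y) < e)) := @compact_space Y.
have UUF : Filter (filter_prod U U) by exact: filter_prod_filter.
move=> /(_ UUF)[x _|[A B] /= [UA UB] AB].
  have [d d0 Hd] := S_equi x _ e40.
  have [p [_ Up]] : [set: Y] `&`
      [set p | iter (m i) S x @[i --> U] --> p] !=set0.
    have := @compact_space Y; rewrite compact_ultra; apply.
      exact: ultra_fmap.
    exact: filterT.
  have UA : U [set i | mdist p (iter (m i) S x) < e / 4].
    have := Up _ (nbhsx_ballx p _ e40).
    by rewrite ballEmdist.
  exists (ball x d, [set ij | mdist p (iter (m ij.1) S x) < e / 4 /\
     mdist p (iter (m ij.2) S x) < e / 4]).
    split => /=; first exact: nbhsx_ballx.
    by exists ([set i | mdist p (iter (m i) S x) < e / 4],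
               [set i | mdist p (iter (m i) S x) < e / 4]) => //=.
  move=> [y [i j]] /= [xy [pi pj]].
  have dS n : mdist (iter n S x) (iter n S y) < e / 4.
    apply: le_lt_trans (Hd n); apply: mdist_le_diam.
      by exists x => //; exact: ballxx.
    by exists y.
  (* Four legs of length [e / 4]: from [y] to [x] at time [m i], then to the limit [p], then to [x]
     at time [m j], then back to [y]. *)
  have -> : e = e / 4 + e / 4 + (e / 4 + e / 4).
    by rewrite -!mulrDl -!mulr2n -mulrnA -[e *+ _]mulr_natr mulfK.
  apply: (le_lt_trans (metric_triangle _ p _)); apply: ltrD.
    apply: (le_lt_trans (metric_triangle _ (iter (m i) S x) _)).
    by rewrite metric_sym ltrD// metric_sym.
  by apply: (le_lt_trans (metric_triangle _ (iter (m j) S x) _)); exact: ltrD.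
have [i [[Ai Bi] Pi]] : A `&` B `&` P !=set0.
  by apply: (@filter_ex _ U); apply: filterI; [exact: filterI|exact: ooU].
have [j [[[Aj Bj] Pj] mij]] :
    A `&` B `&` P `&` [set j | (m i + N <= m j)%N] !=set0.
  apply: (@filter_ex _ U); apply: filterI; last first.
    by apply: ooU; move/cvgnyPge: m_oo; exact.
  by apply: filterI; [exact: filterI|exact: ooU].
by exists i, j; split=> // y; exact: (AB (i, j)).
Qed.

Lemma iter_surj (Z : Type) (f : Z -> Z) n :
  set_surj [set: Z] [set: Z] f -> forall z, exists y, iter n f y = z.
Proof.
move=> fs; elim: n => [|n IH] z; first by exists z.
have [y yz] := IH z; have [x _ xy] := fs y I.
by exists x; rewrite iterSr xy.
Qed.

Lemma iter_inj (Z : Type) (f : Z -> Z) n : injective f -> injective (iter n f).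
Proof. by move=> fI; elim: n => // n IH x y /= /fI /IH. Qed.

(** Two close iterates at times [i < j], together with surjectivity of the [i]-th one, put
    [iter (j - i) S] close to the identity. Since [j - i] is positive, this iterate identifies
    points with the same image under [S], so such points are arbitrarily close. *)
Lemma equicontinuous_inj (Y : compactMetricType R) (S : Y -> Y) :
  set_surj [set: Y] [set: Y] S -> equicontinuous_system S -> injective S.
Proof.
move=> S_surj S_equi x y Sxy; apply: mdist_positivity; apply/eqP.
rewrite eq_le mdist_ge0 andbT; apply/ler_addgt0Pl => e e0; rewrite addr0.
have [|i [j [_ _]]] := @equicontinuous_iter_close Y S id setT (e / 2) 1 S_equi
  (@cvg_id _ _) (filterT) _; first by rewrite divr_gt0.
rewrite addn1 => ij Sij.
have near_id z : mdist z (iter (j - i) S z) < e / 2.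
  by have [w <-] := iter_surj i S_surj z; rewrite -iterD subnK// ltnW.
have Exy : iter (j - i) S x = iter (j - i) S y.
  by rewrite -(subnSK ij) !iterSr Sxy.
rewrite ltW// (le_lt_trans (metric_triangle _ (iter (j - i) S x) _))//.
by rewrite (splitr e) ltrD// Exy metric_sym.
Qed.

(** * Uniform rigidity and the induced map on closed sets *)

Lemma uniform_cvg_mdist (Z : metricType R) (F : nat -> Z -> Z) (f : Z -> Z) :
  {uniform, F @ \oo --> f} <->
  forall e : R, 0 < e -> \forall i \near \oo, forall z, mdist (f z) (F i z) < e.
Proof.
split=> [Ff e e0|Ff P /uniform_nbhs[E [+ EP]]].
  apply: (Ff [set h : {uniform Z -> Z} | forall z, mdist (f z) (h z) < e]).
  apply/uniform_nbhs; exists [set p | ball p.1 e p.2]; split.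
    exact: entourage_ball (PosNum e0).
  by move=> h /= Hh z; have := Hh z I; rewrite ballEmdist.
rewrite -entourage_ballE => -[e /= e0 eE].
apply: filterS (Ff e e0) => i Fi; apply: EP => z _; apply: eE.
by rewrite /= ballEmdist; exact: Fi.
Qed.

Lemma uniformly_rigid_returns (Z : metricType R) (f : Z -> Z) :
  (forall (e : R) (N : nat), 0 < e ->
     exists2 n, (N < n)%N & forall z, mdist z (iter n f z) < e) ->
  uniformly_rigid f.
Proof.
move=> H.
(* The bound [i < n] gives both positivity and divergence of the times; the tolerance gives uniform
   convergence. *)
have /choice[m Hm] : forall i : nat, exists n, (i < n)%N /\
    forall z, mdist z (iter n f z) < i.+1%:R^-1 :> R.
  by move=> i; have [|n] := H i.+1%:R^-1 i; [rewrite invr_gt0|exists n].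
exists m; split.
- by move=> i; exact: leq_ltn_trans (Hm i).1.
- apply/cvgnyPge => A; exists A => // i /= Ai.
  exact: leq_trans Ai (ltnW (Hm i).1).
- apply/uniform_cvg_mdist => e e0.
  have [N _ HN] := near_infty_natSinv_lt (PosNum e0).
  by exists N => // i Ni z; exact: lt_trans ((Hm i).2 z) (HN i Ni).
Qed.

Lemma hset_iter_hyperspace_map (X : compactMetricType R)
    (f : continuousType X X) n (A : hyperspace X) :
  iter n (hyperspace_map f) A = iter n f @` A :> set X.
Proof.
elim: n => [|n IH] /=; first by rewrite image_id.
by rewrite IH image_comp.
Qed.

Lemma hausdorff_dist_image_le (X : compactMetricType R) (h : X -> X)
    (A B : hyperspace X) (e : R) :
  0 < e -> B = h @` A :> set X -> (forall x, mdist x (h x) < e) ->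
  hausdorff_dist A B <= e.
Proof.
move=> e0 BE he; apply: ge_inf; first by case: (hausdorff_radii_has_inf A B).
split=> // [x Ax|]; rewrite BE.
  by exists (h x); [exists x|rewrite ballEmdist /= metric_sym; exact: he].
by move=> _ [x Ax <-]; exists x => //; rewrite ballEmdist; exact: he.
Qed.

Lemma uniformly_rigid_pointwise_recurrent (X : compactMetricType R)
    (f : continuousType X X) :
  uniformly_rigid f -> pointwise_recurrent (hyperspace_map f).
Proof.
move=> [m [_ m_oo /uniform_cvg_mdist mf]] A.
exists (fun i => Posz (m i)); split; first by left; exact/cvgrnyP.
(* Halving [e] restores strictness: [hausdorff_dist_image_le] gives only a weak inequality. *)
apply/cvg_ballP => e e0; have e20 : 0 < e / 2 by rewrite divr_gt0.
apply: filterS (mf _ e20) => i mi; rewrite ballEmdist.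
apply: (@le_lt_trans _ _ (e / 2)); last by rewrite gtr_pMr// invf_lt1// ltr1n.
by apply: (hausdorff_dist_image_le e20 _ mi); exact: hset_iter_hyperspace_map.
Qed.

(** The inverse is the preimage map. Bijectivity makes [iterz] at negative times a genuine inverse,
    as [iterzN] demands. *)
Lemma hyperspace_map_bij (X : compactMetricType R) (f : continuousType X X) :
  set_surj [set: X] [set: X] f -> injective f -> bijective (hyperspace_map f).
Proof.
move=> fs fI.
have cl (B : hyperspace X) : closed (f @^-1` B).
  by apply: closed_comp; [move=> x _; exact: cts_fun|exact: hset_closed].
have n0 (B : hyperspace X) : f @^-1` B !=set0.
  by have [b Bb] := hset_neq0 B; have [x _ xb] := fs b I; exists x; rewrite /= xb.
exists (fun B => Hyperspace (cl B) (n0 B)) => A; apply: hyperspace_eq.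
  apply/seteqP; split=> [x [y Ay /fI <-]|x Ax] //.
  by exists x.
apply/seteqP; split=> [_ [y Ay <-]|x Ax] //.
by have [y _ yx] := fs x I; exists y => //; rewrite /= yx.
Qed.

(** * Small translations and two-sided times *)

(** The metric may fail to be translation invariant, so uniformity in [g] comes from compactness of
    [G] and joint continuity of the product at each [(1, g)]. *)
Lemma mulg_near_id (G : compactMetricGroupType R) (e : R) :
  0 < e -> \forall w \near (1%g : G), forall g : G, mdist g (w * g)%g < e.
Proof.
move=> e0; have e20 : 0 < e / 2 by rewrite divr_gt0.
have /compact_near_coveringP/(_ _ (nbhs (1%g : G)) (fun w g =>
    mdist g (w * g)%g < e)) := @compact_space G.
move=> /(_ _) cov; apply: filterS (cov _) => [w Hw g|g _]; first exact: Hw.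
have := @mulg_continuous G (1%g, g) _ (nbhsx_ballx (1 * g)%g _ e20).
rewrite mul1g => -[[A B] /= [A1 Bg] AB].
exists (B `&` ball g (e / 2), A).
  by split=> //=; apply: filterI => //; exact: nbhsx_ballx.
move=> [h w] /= [[Bh gh] Aw].
apply: (le_lt_trans (metric_triangle _ g _)); rewrite (splitr e).
have := AB (w, h) (conj Aw Bh); move: gh; rewrite !ballEmdist /= => gh gwh.
by rewrite ltrD// metric_sym.
Qed.

Lemma cvg_absz_infty (n : nat -> int) :
  ((n i)%:~R @[i --> \oo] --> (+oo : set_system R)
   \/ (n i)%:~R @[i --> \oo] --> (-oo : set_system R)) ->
  `|n i|%N @[i --> \oo] --> \oo.
Proof.
move=> H; apply/(@cvgrnyP R).
case: H => [/cvgryPge|/cvgrNyPle] H; apply/cvgryPge => A.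
  apply: filterS (H A) => i /le_trans; apply.
  by rewrite pmulrn ler_int abszE ler_norm.
apply: filterS (H (- A)) => i; rewrite lerNr => /le_trans; apply.
by rewrite pmulrn -mulrNz ler_int abszE -normrN ler_norm.
Qed.

(** * The cocycle of a skew product *)

Section skew.
Context {Y : compactMetricType R} {G : compactMetricGroupType R}.
Variables (S : continuousType Y Y) (phi : continuousType Y G).
Let T : continuousType (Y * G)%type (Y * G)%type := skew_product S phi.

(** This is the product [phi(S^(n-1) y) ... phi(y)]. Starting at the unit suffices because the skew
    product commutes with right translations of the fibre. *)
Definition cocycle n y : G := (iter n (skew_product S phi) (y, 1%g)).2.

Lemma iter_skew_product n y g :
  iter n (skew_product S phi) (y, g) = (iter n S y, (cocycle n y * g)%g).
Proof.
rewrite /cocycle; elim: n g => [|n IH] g /=; first by rewrite mul1g.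
by rewrite (IH 1%g) (IH g) /skew_product /= mulg1 mulgA.
Qed.

Lemma cocycleD a b y :
  cocycle (a + b) y = (cocycle a (iter b S y) * cocycle b y)%g.
Proof. by rewrite {1}/cocycle iterD !iter_skew_product /= mulg1. Qed.

Lemma cocycle_uniformly_rigid (m : nat -> nat) :
  set_surj [set: Y] [set: Y] S -> equicontinuous_system S ->
  m i @[i --> \oo] --> \oo ->
  (forall W : set G, nbhs 1%g W ->
     \forall i \near \oo, forall y, W (cocycle (m i) y)) ->
  uniformly_rigid T.
Proof.
move=> S_surj S_equi m_oo mW; apply: uniformly_rigid_returns => e N e0.
have divg_cont : continuous (fun p : G * G => (p.1 * p.2^-1)%g).
  move=> p; apply: (@continuous_comp _ _ _ (fun p : G * G => (p.1, p.2^-1%g))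
    (fun p : G * G => (p.1 * p.2)%g)); last exact: mulg_continuous.
  apply: cvg_pair => /=; first exact: cvg_fst.
  by apply: continuous_comp; [exact: cvg_snd|exact: invg_continuous].
have near1 : nbhs ((1%g : G) * (1%g : G)^-1)%g
    [set w | forall g : G, mdist g (w * g)%g < e].
  by rewrite mulgV; exact: mulg_near_id.
have [[A B] /= [A1 B1] AB] := divg_cont (1%g, 1%g) _ near1.
(* Values in both [A] and [B] let either index serve as numerator or denominator of the quotient;
   [N.+1] makes the time gap strictly exceed [N]. *)
have [i [j [Wi Wj mij Sij]]] := equicontinuous_iter_close N.+1 S_equi m_oo
  (mW _ (filterI A1 B1)) e0.
have lemij : (m i <= m j)%N by apply: leq_trans mij; rewrite leq_addr.
exists (m j - m i)%N; first by rewrite ltn_subRL -addnS.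
(* Writing [z] as [iter (m i) S y] turns the displacement in the base into the distance between the
   two close iterates. *)
move=> [z g]; have [y <-] := iter_surj (m i) S_surj z.
rewrite iter_skew_product -iterD subnK//.
rewrite [mdist _ _]/(Num.max _ _) gt_max /= Sij /=.
have -> : cocycle (m j - m i) (iter (m i) S y) =
    (cocycle (m j) y * (cocycle (m i) y)^-1)%g.
  by rewrite -[in RHS](subnK lemij) cocycleD mulgK.
exact: (AB (_, _) (conj (Wj y).1 (Wi y).2)).
Qed.

Lemma skew_product_surj :
  set_surj [set: Y] [set: Y] S -> set_surj [set: Y * G] [set: Y * G] T.
Proof.
move=> S_surj [y g] _; have [x _ <-] := S_surj y I.
by exists (x, ((phi x)^-1 * g)%g); rewrite //= /skew_product /= mulVKg.
Qed.

Lemma skew_product_inj : injective S -> injective T.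
Proof.
move=> S_inj [y g] [z h] []; rewrite /= => /S_inj <- /mulgI; by move->.
Qed.

(** At a time [n >= 0] the image of the slice contains [c_n(y) g], which is near [g]; right division
    by [g] recovers [c_n(y)]. At time [-n] one has instead [c_n(y) h = g] with [h] near [g], so
    [c_n(y) = g h^-1]. Hence continuity at [g] of both quotients. *)
Lemma slice_close_cocycle (Y0 : [set: Y] !=set0) g (W : set G) :
  bijective (hyperspace_map T) -> injective S -> nbhs 1%g W ->
  exists2 e : R, 0 < e & forall n : int,
    mdist (slice Y0 g) (iterz (hyperspace_map T) n (slice Y0 g)) < e ->
    forall y, W (cocycle `|n|%N y).
Proof.
move=> T_bij S_inj W1.
have cont_l : {for g, continuous (fun h : G => (h * g^-1)%g)}.
  apply: (@continuous_comp _ _ _ (fun h : G => (h, g^-1%g))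
    (fun p : G * G => (p.1 * p.2)%g)); last exact: mulg_continuous.
  by apply: cvg_pair => /=; [exact: cvg_id|exact: cvg_cst].
have cont_r : {for g, continuous (fun h : G => (g * h^-1)%g)}.
  apply: (@continuous_comp _ _ _ (fun h : G => (g, h^-1%g))
    (fun p : G * G => (p.1 * p.2)%g)); last exact: mulg_continuous.
  by apply: cvg_pair => /=; [exact: cvg_cst|exact: invg_continuous].
have Wg : nbhs (g * g^-1)%g W by rewrite mulgV.
have Wl : \forall h \near g, W (h * g^-1)%g := cont_l _ Wg.
have Wr : \forall h \near g, W (g * h^-1)%g := cont_r _ Wg.
have : \forall h \near g, W (h * g^-1)%g /\ W (g * h^-1)%g by exact: filterI.
move=> /(@nbhs_ballP R G)[e /= e0 eW]; exists e => // n.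
move=> /hausdorff_dist_lt[_ _ sub] y.
case: n sub => n sub.
  have [|[y' _] [_ /= ->] [_ /= /eW[/=]]] := sub (iter n T (y, g)).
    rewrite [iterz _ _ _]/= hset_iter_hyperspace_map.
    by exists (y, g).
  by rewrite iter_skew_product mulgK.
(* [Negz n] is the time [-(n+1)]. By [K], the point [(iter n.+1 S y, g)] of the slice comes from
   some [(z, h)] in the set at that time, and injectivity of [S] forces [z = y]. *)
have [_ K] := iterzN n.+1 T_bij.
have /(congr1 (@hset _ _)) := K (slice Y0 g).
rewrite -NegzE hset_iter_hyperspace_map => /seteqP[_].
move=> /(_ (iter n.+1 S y, g)) [//|[z h] Bzh].
rewrite iter_skew_product => -[/(iter_inj (n := n.+1) S_inj) zy gE].
have [[y' _] [_ /= ->] [_ /= /eW[/= _]]] := sub _ Bzh.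
by rewrite -gE zy mulgK.
Qed.

End skew.
End recurrence_and_rigidity.

Theorem theorem5p10 (R : realType) (Y : compactMetricType R)
    (G : compactMetricGroupType R)
    (Y0 : [set: Y] !=set0)
    (S : continuousType Y Y) (S_surj : set_surj [set: Y] [set: Y] S)
    (S_min : minimal S) (S_equi : equicontinuous_system S)
    (phi : continuousType Y G) :
  let T : continuousType (Y * G)%type (Y * G)%type := skew_product S phi in
  let T_K := hyperspace_map T in
  [<-> recurrent T_K (slice Y0 1%g);
       exists g : G, recurrent T_K (slice Y0 g);
       pointwise_recurrent T_K;
       uniformly_rigid T].
Proof.
move=> T T_K.
have S_inj : injective S := equicontinuous_inj S_surj S_equi.
have T_bij : bijective T_K.
  by apply: hyperspace_map_bij; [exact: skew_product_surj|exact: skew_product_inj].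
(* Stated for every [g]: the second statement reaches the third through rigidity, and the third
   gives rigidity by taking the unit slice. *)
have rec_rigid g : recurrent T_K (slice Y0 g) -> uniformly_rigid T.
  move=> [n [n_oo nA]].
  apply: (cocycle_uniformly_rigid S_surj S_equi (cvg_absz_infty n_oo)) => W W1.
  have [e e0 eW] := slice_close_cocycle Y0 g T_bij S_inj W1.
  move/cvg_ballP: nA => /(_ e e0); apply: filterS => i.
  by rewrite ballEmdist => /eW.
tfae.
- by exists 1%g.
- by move=> [g /rec_rigid]; exact: uniformly_rigid_pointwise_recurrent.
- by move=> rec; exact: (rec_rigid 1%g).
- by move=> /uniformly_rigid_pointwise_recurrent; exact.
Qed.
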